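(* Let $c=2$. Then: (i) $n_1S_{n_1}^{\phi}(\mathbf{c}^{(1)})-n_2S_{n_2}^{\phi}(\mathbf{c}^{(2)})=(n_1-n_2)N\sum_{k=1}^\infty b_{kN}(\phi)$. (ii) If $b_k(\phi)\ge0$ for all $k\ge1$ and $\psi(x):=\phi(\cos(2\pi x))$ for $x\in[-1,1]$, then $$T_{N,2}^{\phi}=\frac{N}{n_1n_2}B_{n_1,n_2}^{\psi}-\Big(\frac{n_1}{n_2}-1\Big)N\sum_{k=1}^{\infty}b_{kN}(\phi).$$
   Context: Setting. Two samples of angles $\Theta_1^{(\ell)},\ldots,\Theta_{n_\ell}^{(\ell)}\in[0,2\pi)$, $\ell=1,2$, with $n_\ell\ge2$ and $N:=n_1+n_2$; observations are mutually independent with absolutely continuous distributions (so there are no ties, almost surely). Uniform scores. $r_i^{(\ell)}\in\{1,\ldots,N\}$ is the rank of $\Theta_i^{(\ell)}$ in the pooled sample of size $N$ and $c_i^{(\ell)}:=2\pi r_i^{(\ell)}/N$; $\mathbf{c}^{(\ell)}:=(c_1^{(\ell)},\ldots,c_{n_\ell}^{(\ell)})$. In particular the $N$ pooled ranks form a permutation of $\{1,\ldots,N\}$. Kernel. $\phi:[-1,1]\to\mathbb{R}$ is square integrable with respect to the weight $(1-t^2)^{-1/2}$, with Chebyshev coefficients $b_k(\phi)=\frac{2}{\pi(1+\delta_{k0})}\int_{-1}^1\phi(t)\cos(k\cos^{-1}t)(1-t^2)^{-1/2}\,\mathrm{d}t$ satisfying $b_0(\phi)=0$ and $\sum_{k\ge1}|b_k(\phi)|<\infty$,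 and $\phi(\cos\theta)=\sum_{k\ge1}b_k(\phi)\cos(k\theta)$ for all $\theta$ (so $\phi$ is continuous). Statistics. $S_{n_\ell}^\phi(\mathbf{c}^{(\ell)}):=\frac1{n_\ell}\sum_{i,j=1}^{n_\ell}\phi(\cos(c_i^{(\ell)}-c_j^{(\ell)}))$, $T_{N,2}^\phi:=S_{n_1}^\phi(\mathbf{c}^{(1)})+S_{n_2}^\phi(\mathbf{c}^{(2)})$, and $B_{n_1,n_2}^{\psi}:=\sum_{i,j=1}^{n_1}\psi\big((r_i^{(1)}-r_j^{(1)})/N\big)$. *)

(* Defs.v *)
From HB Require Import structures.
From mathcomp Require Import all_boot all_order all_algebra.
From mathcomp Require Import all_classical all_reals all_analysis.

Set Implicit Arguments.
Unset Strict Implicit.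
Unset Printing Implicit Defensive.

Import Order.TTheory GRing.Theory Num.Theory.
Import numFieldNormedType.Exports.

Local Open Scope classical_set_scope.
Local Open Scope ring_scope.

Definition mutually_independent d (T : measurableType d) (R : realType)
    (P : probability T R) (I : finType) (X : I -> {RV P >-> R}) : Prop :=
  forall (J : {set I}) (A : I -> set R),
    (forall i, i \in J -> measurable (A i)) ->
    P (\bigcap_(i in [set i | i \in J]) (X i @^-1` A i))
      = (\prod_(i in J) P (X i @^-1` A i))%E.

Definition absolutely_continuous d (T : measurableType d) (R : realType)
    (P : probability T R) (X : {RV P >-> R}) : Prop :=
  distribution P X `<< (@lebesgue_measure R).

Definition pooled (aT : Type) (n1 n2 : nat) (X1 : 'I_n1 -> aT) (X2 : 'I_n2 -> aT)
    (i : 'I_n1 + 'I_n2) : aT :=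
  match i with inl i1 => X1 i1 | inr i2 => X2 i2 end.

(* Ranks start at 1; with no ties they are a permutation of {1, ..., #|I|}. *)
Definition rank (R : realType) (I : finType) (x : I -> R) (i : I) : nat :=
  #|[set j | x j <= x i]%SET|.

Definition uniform_score (R : realType) (N r : nat) : R :=
  2 * pi * r%:R / N%:R.

(* 1 / Num.sqrt (1 - t ^+ 2) is 0, by convention, at the endpoints t = -1, 1,
   which form a Lebesgue-null set. *)
Definition chebyshev_weight (R : realType) (t : R) : R :=
  (Num.sqrt (1 - t ^+ 2))^-1.

Definition chebyshev_coef (R : realType) (phi : R -> R) (k : nat) : R :=
  2 / (pi * (1 + (k == 0%N)%:R)) *
  \int[lebesgue_measure]_(t in `[(-1 : R), 1])
    (phi t * cos (k%:R * acos t) * chebyshev_weight t).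

(* Only the values of phi on [-1, 1] are constrained. *)
Definition weighted_square_integrable (R : realType) (phi : R -> R) : Prop :=
  measurable_fun `[(-1 : R), 1] phi /\
  lebesgue_measure.-integrable `[(-1 : R), 1]
    (fun t => (phi t ^+ 2 * chebyshev_weight t)%:E).

Definition kernel_conditions (R : realType) (phi : R -> R) : Prop :=
  [/\ weighted_square_integrable phi,
      chebyshev_coef phi 0 = 0,
      cvgn (fun n => \sum_(1 <= k < n) `|chebyshev_coef phi k|) &
      forall theta : R,
        (fun n => \sum_(1 <= k < n) chebyshev_coef phi k * cos (k%:R * theta))
          @ \oo --> phi (cos theta)].

Definition S_stat (R : realType) (phi : R -> R) (n : nat) (c : 'I_n -> R) : R :=
  n%:R^-1 * \sum_(i < n) \sum_(j < n) phi (cos (c i - c j)).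

Definition T_stat (R : realType) (phi : R -> R) (n1 n2 : nat)
    (c1 : 'I_n1 -> R) (c2 : 'I_n2 -> R) : R :=
  S_stat phi c1 + S_stat phi c2.

Definition B_stat (R : realType) (psi : R -> R) (N n : nat) (r : 'I_n -> nat) : R :=
  \sum_(i < n) \sum_(j < n) psi (((r i)%:R - (r j)%:R) / N%:R).

(* Main.v *)
Require Import Defs.
From HB Require Import structures.
From mathcomp Require Import all_boot all_order all_algebra.
From mathcomp Require Import all_classical all_reals all_analysis.
From mathcomp Require Import ring lra zify.

Set Implicit Arguments.
Unset Strict Implicit.
Unset Printing Implicit Defensive.

Import Order.TTheory GRing.Theory Num.Theory.
Import numFieldNormedType.Exports.

Local Open Scope classical_set_scope.
Local Open Scope ring_scope.


(** Write [f theta = phi (cos theta)], [N = n1 + n2] and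
    [L = \sum_(k >= 1) b_(kN)]. Almost surely there are no ties, so the pooled
    scores are exactly the N equally spaced points [2 pi r / N], whatever the
    data. Summing [f] over the differences between one such point and all N of
    them keeps only the frequencies divisible by N, each with weight N
    ([sum_cos_score]): this is aliasing on the regular N-gon, and it gives the
    constant [N L] ([sum_lattice], [sum_pooled_scores]).

    Hence the symmetric N x N array [f (c_i - c_j)] has constant row sums
    [N L]. Cutting it into the blocks A11, A12, A21, A22 of the two samples,
    A11 + A12 = n1 N L and A21 + A22 = n2 N L, while A12 = A21 by symmetry;
    eliminating the mixed block gives A11 - A22 = (n1 - n2) N L
    ([block_sum_relation]). Since [n_l S_(n_l)] is the sum of the l-th diagonal
    block, this is (i). Since [B] is the sum of A11, solving for A22 in
    [T = A11 / n1 + A22 / n2] gives (ii).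

    The absence of ties ([ae_injective]) comes from Fubini: under independence
    the joint law of two observations is the product of their laws, and the
    diagonal is null for a product with an atomless factor. *)

(** * Cosine sums over a regular polygon *)

Lemma cos_2pin (R : realType) (n : nat) : cos (2 * pi * n%:R) = 1 :> R.
Proof.
have -> : 2 * pi * n%:R = 0 + (pi *+ 2) *+ n :> R.
  by rewrite add0r mulr_natr mulr_natl.
by rewrite (periodicn (@cosD2pi R)) cos0.
Qed.

Lemma sin_2pin (R : realType) (n : nat) : sin (2 * pi * n%:R) = 0 :> R.
Proof.
have -> : 2 * pi * n%:R = 0 + (pi *+ 2) *+ n :> R.
  by rewrite add0r mulr_natr mulr_natl.
by rewrite (periodicn (@sinD2pi R)) sin0.
Qed.

(** This makes [sin (pi k / N)] a legitimate factor to divide by when the cosine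
    sum of frequency k telescopes. *)
Lemma sin_pi_frac_neq0 (R : realType) (N k : nat) :
  (0 < N)%N -> ~~ (N %| k)%N -> sin (pi * k%:R / N%:R) != 0 :> R.
Proof.
move=> N0 Nk.
have NR0 : N%:R != 0 :> R by rewrite pnatr_eq0 -lt0n.
have -> : pi * k%:R / N%:R
    = pi * (k %% N)%:R / N%:R + pi *+ (k %/ N) :> R.
  by rewrite {1}(divn_eq k N) natrD natrM -[pi *+ _]mulr_natr; field.
rewrite (alternatingn (@sinDpi R)) mulf_neq0 ?signr_eq0// gt_eqF//.
apply: sin_gt0_pi.
have s0 : 0 < (k %% N)%:R :> R by rewrite ltr0n lt0n.
have N0R : 0 < N%:R :> R by rewrite ltr0n.
have sN : (k %% N)%:R < N%:R :> R by rewrite ltr_nat ltn_mod.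
have p0 := pi_gt0 R.
by rewrite divr_gt0 ?mulr_gt0//= ltr_pdivrMr// ltr_pM2l.
Qed.

(** Orthogonality of the characters of Z/N in real form. When N divides k each
    term is 1; otherwise, with [h] half the angular step [2 pi k / N],
    multiplying by [sin h] makes the sum telescope through
    [2 sin h cos y = sin (y + h) - sin (y - h)], and the two end terms agree
    because N steps make a whole number of turns. *)
Lemma sum_cos_score (R : realType) (N m k : nat) : (0 < N)%N ->
  \sum_(r < N) cos (k%:R * (uniform_score R N m - uniform_score R N r.+1))
  = if (N %| k)%N then N%:R else 0.
Proof.
move=> N0; have NR0 : N%:R != 0 :> R by rewrite pnatr_eq0 -lt0n.
case: ifPn => [/dvdnP[q ->]|Nk].
  have scoreE r : (q * N)%:R * uniform_score R N r = 2 * pi * (q * r)%:R.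
    by rewrite /uniform_score !natrM; field.
  under eq_bigr do
    rewrite mulrBr !scoreE cosB !cos_2pin !sin_2pin mulr1 mulr0 addr0.
  by rewrite sumr_const card_ord.
set a := k%:R * uniform_score R N m.
set h := pi * k%:R / N%:R : R.
have h0 : sin h != 0 by exact: sin_pi_frac_neq0.
apply: (mulfI h0); rewrite mulr0 mulr_sumr.
pose F r := - sin (a - (r.*2.+1)%:R * h) / 2.
rewrite -(big_mkord xpredT
  (fun r => sin h * cos (k%:R * (uniform_score R N m - uniform_score R N r.+1)))).
rewrite (telescope_sumr_eq F)//; last first.
  move=> r _; rewrite /F.
  have -> : k%:R * (uniform_score R N m - uniform_score R N r.+1)
      = a - (r.+1).*2%:R * h.
    by rewrite /a /h /uniform_score -muln2 natrM; field.
  have -> : a - (r.+1.*2.+1)%:R * h = (a - (r.+1).*2%:R * h) - h.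
    by rewrite -addn1 natrD; ring.
  have -> : a - (r.*2.+1)%:R * h = (a - (r.+1).*2%:R * h) + h.
    by rewrite doubleS -addn2 -addn1 !natrD; ring.
  move: (a - _) => y; by rewrite sinB sinD; field.
rewrite /F.
have -> : a - (N.*2.+1)%:R * h = (a - h) - 2 * pi * k%:R.
  by rewrite -addn1 natrD -muln2 natrM /h; field.
by rewrite mul1r (sinB (a - h)) cos_2pin sin_2pin; ring.
Qed.

(** The truncation at [K * N] is the subsequence along which the sum over
    multiples of N has precisely the terms of the K-th partial sum of
    [b (k * N)]. *)
Lemma sum_multiples (R : realType) (b : nat -> R) (N K : nat) : (0 < N)%N ->
  \sum_(1 <= k < K * N | (N %| k)%N) b k = \sum_(1 <= k < K) b (k * N)%N.
Proof.
move=> N0; elim: K => [|[|K] IH].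
- by rewrite mul0n !big_geq.
- rewrite mul1n [RHS]big_geq// big_nat_cond big_pred0// => k.
  by apply/negP => /andP[/andP[k1 kN] /dvdn_leq]; lia.
rewrite [RHS]big_nat_recr//= -IH.
rewrite (@big_cat_nat _ _ _ (K.+1 * N))//=;
  [|by rewrite muln_gt0|by rewrite leq_mul2r leqnSn orbT].
congr (_ + _).
rewrite big_ltn_cond ?ltn_mul2r ?N0 ?ltnSn// dvdn_mull//.
rewrite big_nat_cond big_pred0 ?addr0// => k.
apply/negP => /andP[/andP[k1 kN] /dvdnP[q kE]]; move: k1 kN.
by rewrite kE !ltn_mul2r N0/= ltnS; lia.
Qed.

(** Exchanging the finite sum over the lattice with the partial sums of the
    cosine series leaves N times the partial sums of [b] over multiples of N.
    Their convergence along the truncations [K * N] is thus inherited from the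
    pointwise convergence of the series of [f], and the limit is identified at
    the same time. *)
Lemma sum_lattice (R : realType) (f : R -> R) (b : nat -> R) (N m : nat) :
  (0 < N)%N ->
  (forall theta, (fun n => \sum_(1 <= k < n) b k * cos (k%:R * theta))
     @ \oo --> f theta) ->
  \sum_(r < N) f (uniform_score R N m - uniform_score R N r.+1)
  = N%:R * limn (fun K => \sum_(1 <= k < K) b (k * N)%N).
Proof.
move=> N0 fE.
have NR0 : N%:R != 0 :> R by rewrite pnatr_eq0 -lt0n.
set S := LHS.
pose t r := uniform_score R N m - uniform_score R N r.+1.
pose U n : R := \sum_(r < N) \sum_(1 <= k < n) b k * cos (k%:R * t r).
have US : U n @[n --> \oo] --> S.
  by apply: cvg_big => [|r _]; [exact: add_continuous|exact: fE].
have UE n : U n = N%:R * \sum_(1 <= k < n | (N %| k)%N) b k.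
  rewrite /U exchange_big/= mulr_sumr [RHS]big_mkcond/=.
  apply: eq_bigr => k _; rewrite -mulr_sumr sum_cos_score//.
  by case: ifP => _; rewrite ?mulr0// mulrC.
have subS : U (K * N)%N @[K --> \oo] --> S.
  apply: (cvg_comp (fun K => K * N)%N _ _ US).
  by apply: cvg_mulnr.
(* Dividing by N turns the subsequence into the partial sums of the goal. *)
have bS : (fun K => \sum_(1 <= k < K) b (k * N)%N) @ \oo --> N%:R^-1 * S.
  have -> : (fun K => \sum_(1 <= k < K) b (k * N)%N)
      = (fun K => N%:R^-1 * U (K * N)%N).
    by apply/funext => K; rewrite UE sum_multiples// mulKf.
  by apply: cvgMr.
by rewrite (cvg_lim _ bS)// mulVKf.
Qed.

(** * Ranks without ties *)

Lemma rank_lt (R : realType) (I : finType) (x : I -> R) (i j : I) :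
  x i < x j -> (rank x i < rank x j)%N.
Proof.
move=> ij; apply: proper_card; apply/properP; split.
  by apply/fintype.subsetP => k; rewrite !inE => /le_trans; apply; exact: ltW.
by exists j; rewrite !inE ?lexx// -ltNge.
Qed.

Lemma rank_gt0 (R : realType) (I : finType) (x : I -> R) (i : I) :
  (0 < rank x i)%N.
Proof. by apply/card_gt0P; exists i; rewrite inE. Qed.

Lemma rank_le (R : realType) (I : finType) (x : I -> R) (i : I) :
  (rank x i <= #|I|)%N.
Proof. exact: max_card. Qed.

Lemma rank_inj (R : realType) (I : finType) (x : I -> R) :
  injective x -> injective (rank x).
Proof.
move=> xI i j ij; apply: xI.
by case: (ltgtP (x i) (x j)) => // /rank_lt; rewrite ij ltnn.
Qed.

(** Without ties the ranks run through 1, ..., #|I| once each; the index [r] on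
    the right starts at 0, hence [r.+1]. *)
Lemma sum_rank (R : realType) (I : finType) (x : I -> R) (V : nmodType)
    (g : nat -> V) : injective x ->
  \sum_i g (rank x i) = \sum_(r < #|I|) g r.+1.
Proof.
move=> xI.
have lt_rank i : ((rank x i).-1 < #|I|)%N by rewrite prednK ?rank_gt0 ?rank_le.
pose h i := Ordinal (lt_rank i).
have hI : injective h.
  move=> i j [/(congr1 succn)]; rewrite !prednK ?rank_gt0// => /rank_inj.
  exact.
rewrite (reindex h)/=; last by apply/onW_bij/inj_card_bij => //; rewrite card_ord.
by apply: eq_bigr => i _; rewrite prednK ?rank_gt0.
Qed.

(** The sum depends neither on the data nor on [i]: in the array of the values
    [f (c_i - c_j)] all rows have the same sum. *)
Lemma sum_pooled_scores (R : realType) (I : finType) (x : I -> R) (f : R -> R)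
    (b : nat -> R) (i : I) :
  injective x ->
  (forall theta, (fun n => \sum_(1 <= k < n) b k * cos (k%:R * theta))
     @ \oo --> f theta) ->
  let c j := uniform_score R #|I| (rank x j) in
  \sum_j f (c i - c j)
  = #|I|%:R * limn (fun K => \sum_(1 <= k < K) b (k * #|I|)%N).
Proof.
move=> xI fE c; rewrite /c.
rewrite (sum_rank (fun r => f (uniform_score R #|I| (rank x i)
                               - uniform_score R #|I| r)))//.
by apply: sum_lattice => //; apply/card_gt0P; exists i.
Qed.

(** * Almost sure absence of ties *)

Lemma diagonal_measurable (R : realType) :
  measurable [set z : R * R | z.1 = z.2].
Proof.
have -> : [set z : R * R | z.1 = z.2]
    = setT `&` (fun z => z.1 - z.2) @^-1` [set 0].
  rewrite setTI; apply/seteqP; split => z /= => [->|/eqP]; first by rewrite subrr.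
  by rewrite subr_eq0 => /eqP.
apply: (measurable_realfun.measurable_funB measurable_fst measurable_snd) => //.
Qed.

(** The law of (X, Y) agrees with the product of the marginals on rectangles,
    hence everywhere. The product measure of the diagonal is the integral over x
    of the Y-mass of the singleton {x}, which is zero. *)
Lemma ae_neq d (T : measurableType d) (R : realType) (P : probability T R)
    (X Y : {RV P >-> R}) :
  (forall A B : set R, measurable A -> measurable B ->
    P (X @^-1` A `&` Y @^-1` B) = (P (X @^-1` A) * P (Y @^-1` B))%E) ->
  absolutely_continuous Y ->
  {ae P, forall w, X w != Y w}.
Proof.
move=> indep acY.
have mXY : measurable_fun setT (fun w => (X w, Y w)).
  by apply: measurable_fun_pair.
pose XYm := isMeasurableFun.Build _ _ _ _ (fun w => (X w, Y w)) mXY.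
pose XY : {mfun T >-> (R * R)%type} := HB.pack (fun w => (X w, Y w)) XYm.
have prodE : (distribution P X \x distribution P Y)%E [set z | z.1 = z.2]
           = distribution P XY [set z | z.1 = z.2].
  apply: product_measure_unique => [A B mA mB|].
    by rewrite -indep.
  exact: diagonal_measurable.
have Y0 y : distribution P Y [set y] = 0%E.
  apply: (acY [set y]) => //.
  by apply/measure0_null_setP => //; exact: lebesgue_measure_set1.
have PXY0 : P [set w | X w = Y w] = 0%E.
  rewrite -[LHS]/(distribution P XY [set z | z.1 = z.2]) -prodE.
  apply: integral0_eq => x _ /=.
  rewrite -(Y0 x); congr (distribution P Y _).
  by apply/seteqP; split => y; rewrite xsectionE /=.
exists [set w | X w = Y w]; split => //.
- have -> : [set w | X w = Y w] = setT `&` (fun w => (X w, Y w)) @^-1` [set z | z.1 = z.2].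
    by rewrite setTI.
  by apply: (mXY) => //; exact: diagonal_measurable.
- by move=> w /= /negP; rewrite negbK => /eqP.
Qed.

Lemma ae_injective d (T : measurableType d) (R : realType)
    (P : probability T R) (I : finType) (X : I -> {RV P >-> R}) :
  mutually_independent X -> (forall i, absolutely_continuous (X i)) ->
  {ae P, forall w, injective (fun i => X i w)}.
Proof.
move=> indep ac.
have : {ae P, forall w, forall i j : I, i != j -> X i w != X j w}.
  apply: filter_forall => i; apply: filter_forall => j.
  have [->|ij] := eqVneq i j; first by apply: nearW.
  apply: filterS (_ : {ae P, forall w, X i w != X j w}) => [w Xij _//|].
  apply: ae_neq => // A B mA mB.
  (* Only the values of C at i and j matter, as the subfamily is {i, j}. *)
  pose C k := if k == i then A else B.
  have := indep [set i; j]%SET C.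
  rewrite big_setU1 ?inE//= big_set1 /C eqxx (eq_sym j) (negbTE ij).
  move=> <-; last by move=> k _; case: ifP.
  congr (P _); apply/seteqP; split => w /=.
    move=> [Aw Bw] k /=; rewrite !inE => /orP[]/eqP->; first by rewrite eqxx.
    by rewrite eq_sym (negbTE ij).
  move=> Cw; split.
    by have := Cw i; rewrite /= !inE eqxx => /(_ isT).
  by have := Cw j; rewrite /= !inE eqxx orbT eq_sym (negbTE ij) => /(_ isT).
apply: filterS => w Xw i j /eqP; have [//|ij] := eqVneq i j.
by rewrite (negbTE (Xw _ _ ij)).
Qed.


(** * Comparison of the two samples *)

(** The mixed blocks of a symmetric array have the same sum, so that two
    expressions of it through the row sums can be equated. *)
Lemma block_sum_relation (V : zmodType) (n1 n2 : nat)
    (a : 'I_n1 + 'I_n2 -> 'I_n1 + 'I_n2 -> V) (s : V) :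
  (forall i j, a i j = a j i) -> (forall i, \sum_j a i j = s) ->
  \sum_(i < n1) \sum_(j < n1) a (inl i) (inl j) + s *+ n2
  = \sum_(i < n2) \sum_(j < n2) a (inr i) (inr j) + s *+ n1.
Proof.
move=> aC asum.
have row1 : \sum_(i < n1) \sum_(j < n1) a (inl i) (inl j)
    + \sum_(i < n1) \sum_(j < n2) a (inl i) (inr j) = s *+ n1.
  rewrite -big_split/= -[in RHS](card_ord n1) -sumr_const.
  by apply: eq_bigr => i _; rewrite -(asum (inl i)) big_sumType.
have row2 : \sum_(i < n1) \sum_(j < n2) a (inl i) (inr j)
    + \sum_(i < n2) \sum_(j < n2) a (inr i) (inr j) = s *+ n2.
  rewrite exchange_big/= -big_split/= -[in RHS](card_ord n2) -sumr_const.
  apply: eq_bigr => i _; rewrite -(asum (inr i)) big_sumType/=.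
  by congr (_ + _); apply: eq_bigr => j _; rewrite aC.
by rewrite -row1 -row2 !addrA addrC addrA.
Qed.

Theorem proposition2p1 (R : realType) (d : measure_display)
    (Omega : measurableType d) (P : probability Omega R)
    (n1 n2 : nat) (hn1 : (2 <= n1)%N) (hn2 : (2 <= n2)%N)
    (Theta1 : 'I_n1 -> {RV P >-> R}) (Theta2 : 'I_n2 -> {RV P >-> R})
    (hrange : forall (i : 'I_n1 + 'I_n2) (w : Omega),
        0 <= pooled Theta1 Theta2 i w < 2 * pi)
    (hindep : mutually_independent (pooled Theta1 Theta2))
    (hac : forall i : 'I_n1 + 'I_n2,
        absolutely_continuous (pooled Theta1 Theta2 i))
    (phi : R -> R) (hphi : kernel_conditions phi) :
  let N : nat := (n1 + n2)%N in
  let b : nat -> R := chebyshev_coef phi in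
  let rk (w : Omega) : 'I_n1 + 'I_n2 -> nat :=
    rank (fun i => pooled Theta1 Theta2 i w) in
  let r1 (w : Omega) (i : 'I_n1) : nat := rk w (inl i) in
  let r2 (w : Omega) (i : 'I_n2) : nat := rk w (inr i) in
  let c1 (w : Omega) (i : 'I_n1) : R := uniform_score R N (r1 w i) in
  let c2 (w : Omega) (i : 'I_n2) : R := uniform_score R N (r2 w i) in
  {ae P, forall w : Omega,
     n1%:R * S_stat phi (c1 w) - n2%:R * S_stat phi (c2 w)
     = (n1%:R - n2%:R) * N%:R * limn (fun K => \sum_(1 <= k < K) b (k * N)%N)}
  /\
  ((forall k : nat, (1 <= k)%N -> 0 <= b k) ->
   forall psi : R -> R,
     (forall x : R, x \in `[-1, 1] -> psi x = phi (cos (2 * pi * x))) ->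
     {ae P, forall w : Omega,
        T_stat phi (c1 w) (c2 w)
        = N%:R / (n1%:R * n2%:R) * B_stat psi N (r1 w)
          - (n1%:R / n2%:R - 1) * N%:R
            * limn (fun K => \sum_(1 <= k < K) b (k * N)%N)}).
Proof.
move=> N b rk r1 r2 c1 c2.
have [_ _ _ phiE] := hphi.
set L := limn _.
have cardI : #|{: 'I_n1 + 'I_n2}| = N by rewrite card_sum !card_ord.
have n10 : n1%:R != 0 :> R by rewrite pnatr_eq0 -lt0n ltnW.
have n20 : n2%:R != 0 :> R by rewrite pnatr_eq0 -lt0n ltnW.
have N0 : (0 < N)%N by rewrite addn_gt0 ltnW.
have NR0 : 0 < N%:R :> R by rewrite ltr0n.
pose A1 w : R := \sum_(i < n1) \sum_(j < n1) phi (cos (c1 w i - c1 w j)).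
pose A2 w : R := \sum_(i < n2) \sum_(j < n2) phi (cos (c2 w i - c2 w j)).
have diffA : {ae P, forall w, A1 w - A2 w = (n1%:R - n2%:R) * N%:R * L}.
  apply: filterS (ae_injective hindep hac) => w wI.
  pose c i := uniform_score R N (rk w i).
  have sumc i : \sum_j phi (cos (c i - c j)) = N%:R * L.
    by have := sum_pooled_scores i wI phiE; rewrite cardI.
  have sym i j : phi (cos (c i - c j)) = phi (cos (c j - c i)).
    by rewrite -cosN opprB.
  have A12 : A1 w + N%:R * L *+ n2 = A2 w + N%:R * L *+ n1.
    exact: block_sum_relation sym sumc.
  by rewrite -(addrK (N%:R * L *+ n2) (A1 w)) A12; ring.
have S1E w : S_stat phi (c1 w) = n1%:R^-1 * A1 w by [].
have S2E w : S_stat phi (c2 w) = n2%:R^-1 * A2 w by [].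
split.
  apply: filterS diffA => w <-.
  by rewrite S1E S2E !mulVKf.
move=> _ psi psiE; apply: filterS diffA => w A12.
have -> : B_stat psi N (r1 w) = A1 w.
  apply: eq_bigr => i _; apply: eq_bigr => j _.
  have r1_le k : (r1 w k)%:R <= N%:R :> R by rewrite ler_nat -cardI rank_le.
  have r1_ge k : 0 <= (r1 w k)%:R :> R by [].
  (* Ranks lie in [0, N], so the arguments of psi stay in [-1, 1]. *)
  rewrite psiE.
    by congr (phi (cos _)); rewrite /c1 /uniform_score; ring.
  rewrite in_itv/= ler_pdivlMr// ler_pdivrMr//.
  have := r1_le i; have := r1_le j; have := r1_ge i; have := r1_ge j.
  by move=> *; apply/andP; split; lra.
rewrite /T_stat S1E S2E.
have -> : A2 w = A1 w - (n1%:R - n2%:R) * N%:R * L by rewrite -A12; ring.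
by rewrite natrD; field; rewrite n10 n20.
Qed.
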